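(* Assume that for every bipartite graph $B$ with nonnegative edge weights and every $\delta>0$, the subroutine PERMANENT$(B,\delta)$ returns a value approximating the weighted permanent of $B$ within accuracy $\delta$. Then for every graph $G$ and every $\varepsilon>0$, RECURSIVE-COUNT$(G,\varepsilon)$ returns a value approximating the number of perfect matchings of $G$ within accuracy $\varepsilon$.
   Context: A value $\tilde Z$ approximates $Z\ge 0$ within accuracy $\delta$ if $e^{-\delta}Z\le\tilde Z\le e^{\delta}Z$. The weighted permanent of a bipartite graph $B$ with parts $X,Y$ and edge weights $w$ is $\sum_{M}\prod_{e\in M}w(e)$, the sum over perfect matchings $M$ of $B$ (matchings covering all of $X\cup Y$; it is $0$ if none exist). Gallai–Edmonds decomposition of a graph $F$: $D(F)$ is the set of vertices left unmatched by at least one maximum matching of $F$; $A(F)$ is the set of vertices not in $D(F)$ adjacent to at least one vertex of $D(F)$; $C(F)$ is the set of remaining vertices. Algorithm RECURSIVE-COUNT$(G,\varepsilon)$, where $n=|V(G)|$: 1. If $V(G)=\emptyset$, return $1$. 2. Choose a vertex $u\in V(G)$ (arbitrarily). 3. Compute the Gallai–Edmonds decomposition $D=D(G-u)$, $A=A(G-u)$, $C=C(G-u)$ of $G-u$. 4. For every $v\in D$, let $H_v$ be the connected component of the induced subgraph $G[D]$ containing $v$, and let $m_v=$ RECURSIVE-COUNT$(H_v-v,\varepsilon/(2n))$. 5. Let $m_C=$ RECURSIVE-COUNT$(G[C],\varepsilon/3)$. 6. Let $X=A\cup\{u\}$ and let $Y$ be the set of connected components of $G[D]$. Let $G'$ be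 the bipartite graph on $(X,Y)$ where, for $x\in X$ and $H\in Y$, if $x$ has at least one neighbor (in $G$) in $H$, there is an edge $\{x,H\}$ of weight $w(x,H)=\sum_{v\in N(x)\cap V(H)}m_v$. 7. Return $m_C\cdot$ PERMANENT$(G',\varepsilon/3)$. *)

(* Defs.v *)
From HB Require Import structures.
From mathcomp Require Import all_boot all_order all_algebra.
From mathcomp Require Import reals sequences exp.

Set Implicit Arguments.
Unset Strict Implicit.
Unset Printing Implicit Defensive.

Import Order.TTheory GRing.Theory Num.Theory.
Local Open Scope ring_scope.

(* A finite simple graph is a symmetric
   irreflexive relation [e] on a finType [T].  All the graphs met by the
   algorithm are induced subgraphs of the input graph; the induced subgraph on
   [S : {set T}] is represented by [S] itself, [e] being fixed. *)

Definition approximates (R : realType) (delta z Z : R) : Prop :=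
  expR (- delta) * Z <= z <= expR delta * Z.

(* A possibly nondeterministic computation is given by the set [out] of the
   values it may return. *)
Definition returns_approx (R : realType) (out : R -> Prop) (delta Z : R) :
    Prop :=
  (exists z, out z) /\ (forall z, out z -> approximates delta z Z).

Section Matchings.
Variables (T : finType) (e : rel T).
Implicit Types (S D : {set T}) (M : {set {set T}}).

Definition edges S : {set {set T}} :=
  [set [set x; y] | x in S, y in S & e x y].

Definition is_matching S M : bool := (M \subset edges S) && trivIset M.

Definition is_perfect_matching S M : bool :=
  is_matching S M && (cover M == S).

Definition num_perfect_matchings S : nat :=
  #|[set M | is_perfect_matching S M]|.

Definition is_maximum_matching S M : bool :=
  is_matching S M &&
  [forall M' : {set {set T}}, is_matching S M' ==> (#|M'| <= #|M|)%N].

Definition GE_D S : {set T} :=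
  [set v in S | [exists M, is_maximum_matching S M && (v \notin cover M)]].

Definition GE_A S : {set T} :=
  [set v in S :\: GE_D S | [exists w in GE_D S, e v w]].

Definition GE_C S : {set T} := S :\: (GE_D S :|: GE_A S).

(* Meaningful for [v \in D] only. *)
Definition component D (v : T) : {set T} :=
  [set w in D | connect [rel x y | [&& x \in D, y \in D & e x y]] v w].

Definition components D : {set {set T}} := [set component D v | v in D].

End Matchings.

(* The parts are subsets of two separate finTypes and an edge is an ordered
   pair.  Only the values of [bweight] on edges are relevant. *)
Record wbigraph (R : realType) (U V : finType) := WBigraph {
  lpart : {set U};
  rpart : {set V};
  bedge : U -> V -> bool;
  bweight : U -> V -> R }.

Section Permanent.
Variables (R : realType) (U V : finType) (B : wbigraph R U V).

Definition bedges : {set U * V} :=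
  [set p in setX (lpart B) (rpart B) | bedge B p.1 p.2].

Definition nonneg_weights : Prop :=
  forall p, p \in bedges -> 0 <= bweight B p.1 p.2.

Definition is_bperfect_matching (M : {set U * V}) : bool :=
  [&& M \subset bedges,
      [forall x in lpart B, #|[set p in M | p.1 == x]| == 1%N] &
      [forall y in rpart B, #|[set p in M | p.2 == y]| == 1%N]].

Definition weighted_permanent : R :=
  \sum_(M : {set U * V} | is_bperfect_matching M)
    \prod_(p in M) bweight B p.1 p.2.

End Permanent.

(* [P U V B delta z] means that [z] is a possible return value of the
   subroutine on the weighted bipartite graph [B] and the accuracy [delta]. *)
Definition permanent_subroutine (R : realType) : Type :=
  forall U V : finType, wbigraph R U V -> R -> R -> Prop.

Section RecursiveCount.
Variables (R : realType) (PERMANENT : permanent_subroutine R).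
Variables (T : finType) (e : rel T).

Definition reduced_bigraph (u : T) (A D : {set T}) (m : T -> R) :
    wbigraph R T {set T} :=
  {| lpart := u |: A;
     rpart := components e D;
     bedge := fun x H => [exists v in H, e x v];
     bweight := fun x H => \sum_(v in H | e x v) m v |}.

(* [recursive_count S eps z] means that some run on the induced subgraph on [S]
   with accuracy [eps] returns [z].  The choice of [u] is arbitrary in every
   call, and the values of [m] outside [D] are never used. *)
Inductive recursive_count : {set T} -> R -> R -> Prop :=
| RC_empty (eps : R) : recursive_count set0 eps 1
| RC_step (S : {set T}) (eps : R) (u : T) (m : T -> R) (mC p : R) :
    let D := GE_D e (S :\ u) in
    let A := GE_A e (S :\ u) in
    let C := GE_C e (S :\ u) in
    u \in S ->
    (forall v, v \in D ->
       recursive_count (component e D v :\ v) (eps / (2 * #|S|%:R)) (m v)) ->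
    recursive_count C (eps / 3) mC ->
    PERMANENT (reduced_bigraph u A D m) (eps / 3) p ->
    recursive_count S eps (mC * p).

End RecursiveCount.

(* Main.v *)
(* Let u be a vertex of S, and let D, A, C be the Gallai-Edmonds decomposition of
   S - u.  If S has a perfect matching, D is the set of the v such that S - u - v
   has one, and every perfect matching of S matches A + u bijectively to the
   components of D, each of them being hit by exactly one edge, and C to itself.
   All of this follows from one exchange property of the vertex sets that have a
   perfect matching.  Removing the vertices of A + u one at a time then gives
     pm(S) = pm(C) * sum_M prod_((x, H) in M) sum_(v in H, x ~ v) pm(H - v),
   M ranging over the perfect matchings of the bipartite graph; if S has no perfect
   matching, both sides vanish.  The accuracies add up along the factors. *)

Require Import Defs.
From HB Require Import structures.
From mathcomp Require Import all_boot all_order all_algebra.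
From mathcomp Require Import reals sequences exp.
From mathcomp Require Import ring lra.
From mathcomp Require boolp.

Set Implicit Arguments.
Unset Strict Implicit.
Unset Printing Implicit Defensive.

Import Order.TTheory GRing.Theory Num.Theory.
Local Open Scope ring_scope.

(** Proves equalities of sets that differ by named points: [z] is compared with each point, the
    memberships and disequalities in the context settle those cases, and away from the points one
    membership of [z] decides. *)
Ltac set_cases :=
  let z := fresh "z" in
  apply/setP => z; rewrite !inE;
  repeat (case: (z =P _) => [->|_]);
  repeat match goal with
  | |- context [?a == ?a] => rewrite (eqxx a)
  | H : is_true ?b |- context [?b] => rewrite H
  | H : is_true (~~ ?b) |- context [?b] => rewrite (negbTE H)
  | H : is_true (~~ (?a == ?b)) |- context [?b == ?a] =>
      rewrite (eq_sym b a) (negbTE H)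
  end; rewrite ?andbF ?andbT ?orbF ?orbT ?addbF ?addbT //=;
  try by case: (z \in _).

(** * Weighted permanents *)

Section BipartitePermanent.
Variables (R : realType) (U V : finType) (b : U -> V -> bool) (w : U -> V -> R).
Local Notation B X Y := (WBigraph X Y b w).
Implicit Types (X : {set U}) (Y : {set V}) (M : {set U * V}).

(** Each count equal to one splits into the existence of an edge at the vertex and the injectivity
    of a projection on [M]. *)
Lemma bperfect_matchingP X Y M :
  reflect [/\ {in M, forall p, [/\ p.1 \in X, p.2 \in Y & b p.1 p.2]},
              {in X, forall x, exists y, (x, y) \in M},
              {in Y, forall y, exists x, (x, y) \in M},
              {in M &, injective fst} & {in M &, injective snd}]
    (is_bperfect_matching (B X Y) M).
Proof.
apply: (iffP and3P) => [[/subsetP sM /forall_inP /= hX /forall_inP /= hY]|].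
  have sM' p : p \in M -> [/\ p.1 \in X, p.2 \in Y & b p.1 p.2].
    by move=> /sM; rewrite !inE => /andP[/andP[]].
  split=> //.
  - move=> x /hX/cards1P[[x' y] /setP E]; exists y.
    have := E (x', y); rewrite !inE eqxx => /andP[xyM /eqP /= <-]; exact: xyM.
  - move=> y /hY/cards1P[[x y'] /setP E]; exists x.
    have := E (x, y'); rewrite !inE eqxx => /andP[xyM /eqP /= <-]; exact: xyM.
  - move=> p q pM qM pq; have [pX _ _] := sM' p pM.
    have /cards1P[z /setP E] := hX _ pX.
    have := E p; have := E q; rewrite !inE pM qM -pq eqxx.
    by move=> /esym/eqP-> /esym/eqP->.
  - move=> p q pM qM pq; have [_ pY _] := sM' p pM.
    have /cards1P[z /setP E] := hY _ pY.
    have := E p; have := E q; rewrite !inE pM qM -pq eqxx.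
    by move=> /esym/eqP-> /esym/eqP->.
move=> [sM hX hY i1 i2]; split.
- by apply/subsetP => p /sM[pX pY bp]; rewrite !inE pX pY.
- apply/forall_inP => x /hX[y xyM]; apply/cards1P; exists (x, y).
  apply/setP => p; rewrite !inE; apply/andP/eqP => [[pM /eqP px]|->//].
  exact: i1.
- apply/forall_inP => y /hY[x xyM]; apply/cards1P; exists (x, y).
  apply/setP => p; rewrite !inE; apply/andP/eqP => [[pM /eqP px]|->//].
  exact: i2.
Qed.

Lemma card_bperfect_matching X Y M :
  is_bperfect_matching (B X Y) M -> #|M| = #|X| /\ #|M| = #|Y|.
Proof.
move=> /bperfect_matchingP[sM hX hY i1 i2].
rewrite -{1}(card_in_imset i1) -(card_in_imset i2).
split; apply: eq_card => z; apply/imsetP/idP.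
- by move=> [p /sM[? _ _] ->].
- by move=> /hX[y zM]; exists (z, y).
- by move=> [p /sM[_ ? _] ->].
- by move=> /hY[x zM]; exists (x, z).
Qed.

(** The condition [(x, y) \notin M] makes adding this edge invertible, so the equality can serve as
    the index condition of a reindexed sum. *)
Lemma bperfect_matching_setU1 X Y M x y :
  x \in X -> y \in Y -> b x y ->
  is_bperfect_matching (B X Y) ((x, y) |: M) && ((x, y) \notin M) =
  is_bperfect_matching (B (X :\ x) (Y :\ y)) M.
Proof.
move=> xX yY bxy; apply/andP/idP => [[/bperfect_matchingP[sM hX hY i1 i2] nM]|].
  have inM p : p \in M -> p \in (x, y) |: M by rewrite !inE orbC => ->.
  have n1 p : p \in M -> p.1 != x.
    move=> pM; apply: contraNneq nM => px.
    by have <- : p = (x, y) by apply: i1; rewrite ?setU11 // inM.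
  have n2 p : p \in M -> p.2 != y.
    move=> pM; apply: contraNneq nM => px.
    by have <- : p = (x, y) by apply: i2; rewrite ?setU11 // inM.
  apply/bperfect_matchingP; split.
  - move=> p pM; have [] := sM p (inM p pM).
    by rewrite !inE n1 // n2.
  - move=> x' /setD1P[x'x /hX[y']]; rewrite !inE => /orP[/eqP[]|].
      by move=> /eqP; rewrite (negbTE x'x).
    by exists y'.
  - move=> y' /setD1P[x'x /hY[x']]; rewrite !inE => /orP[/eqP[_]|].
      by move=> /eqP; rewrite (negbTE x'x).
    by exists x'.
  - by move=> p q /inM pM /inM qM; apply: i1.
  - by move=> p q /inM pM /inM qM; apply: i2.
move=> /bperfect_matchingP[sM hX hY i1 i2]; split; last first.
  by apply/negP => /sM[]; rewrite !inE eqxx.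
apply/bperfect_matchingP; split.
- move=> p /setU1P[->//|/sM[]]; rewrite !inE.
  by move=> /andP[_ ->] /andP[_ ->].
- move=> x' x'X; have [->|x'x] := eqVneq x' x; first by exists y; rewrite !inE eqxx.
  have [|y' My'] := hX x'; first by rewrite !inE x'x.
  by exists y'; rewrite !inE My' orbT.
- move=> y' y'Y; have [->|y'y] := eqVneq y' y; first by exists x; rewrite !inE eqxx.
  have [|x' Mx'] := hY y'; first by rewrite !inE y'y.
  by exists x'; rewrite !inE Mx' orbT.
- move=> p q /setU1P[->|pM] /setU1P[->|qM] //=.
  + by move=> xq; have [] := sM q qM; rewrite -xq !inE eqxx.
  + by move=> xq; have [] := sM p pM; rewrite xq !inE eqxx.
  + exact: i1.
- move=> p q /setU1P[->|pM] /setU1P[->|qM] //=.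
  + by move=> xq; have [_] := sM q qM; rewrite -xq !inE eqxx.
  + by move=> xq; have [_] := sM p pM; rewrite xq !inE eqxx.
  + exact: i2.
Qed.

(** Laplace expansion along the row of [x]. *)
Lemma weighted_permanent_expand X Y x : x \in X ->
  weighted_permanent (B X Y) =
  \sum_(y in Y | b x y) w x y * weighted_permanent (B (X :\ x) (Y :\ y)).
Proof.
move=> xX; rewrite /weighted_permanent.
(* The inner sum reduces to the term of the unique edge of [M] at [x]. *)
transitivity (\sum_(M | is_bperfect_matching (B X Y) M)
  \sum_(y in Y | b x y) if (x, y) \in M then \prod_(p in M) w p.1 p.2 else 0).
  apply: eq_bigr => M /bperfect_matchingP[sM hX hY i1 i2].
  have [y xyM] := hX x xX; have [_ /= yY bxy] := sM _ xyM.
  rewrite (bigD1 y) ?yY //= xyM [X in _ + X]big1 ?addr0 // => z /andP[_ zy].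
  case: ifP => // xzM; case/eqP: zy.
  by have [] := i1 _ _ xzM xyM erefl.
rewrite exchange_big /=; apply: eq_bigr => y /andP[yY bxy].
rewrite -big_mkcondr /= big_distrr /=.
rewrite (reindex_onto (fun M => (x, y) |: M) (fun M => M :\ (x, y))) /=; last first.
  by move=> M /andP[_ ?]; rewrite setD1K.
have E M : ((x, y) |: M) :\ (x, y) == M = ((x, y) \notin M).
  apply/eqP/idP => [<-|]; first by rewrite !inE eqxx.
  exact: setU1K.
apply: eq_big => [M|M].
  by rewrite E !inE eqxx andbT bperfect_matching_setU1.
by rewrite E => /andP[_ nM]; rewrite big_setU1.
Qed.

Lemma weighted_permanent_set0 Y : weighted_permanent (B set0 Y) = (Y == set0)%:R.
Proof.
have [->|[y yY]] := set_0Vmem Y.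
  rewrite eqxx /weighted_permanent (big_pred1 set0) ?big_set0 // => M /=.
  apply/bperfect_matchingP/eqP => [[sM _ _ _ _]|->].
    by apply/eqP/negPn/negP => /set0Pn[p /sM[]]; rewrite inE.
  by split=> [p|x|y|p q|p q]; rewrite inE.
have -> : (Y == set0) = false by apply/negbTE/set0Pn; exists y.
rewrite /weighted_permanent big_pred0 // => M.
apply/negP => /bperfect_matchingP[sM _ hY _ _].
by have [x /sM[]] := hY _ yY; rewrite inE.
Qed.

End BipartitePermanent.

(** * Sets of vertices having a perfect matching *)

Section PerfectMatchings.
Variables (T : finType) (e : rel T).
Hypotheses (e_sym : symmetric e) (e_irrefl : irreflexive e).
Implicit Types (S X Y : {set T}) (M : {set {set T}}).

Local Notation N S := (num_perfect_matchings e S).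
Local Notation feasible S := (0 < N S)%N.
Local Notation is_pm := (is_perfect_matching e).

Lemma edgesP S (E : {set T}) :
  reflect (exists x y, [/\ x \in S, y \in S, e x y & E = [set x; y]])
    (E \in edges e S).
Proof.
apply: (iffP imset2P) => [[x y xS]|[x [y [xS yS exy ->]]]].
  by rewrite inE => /andP[yS exy] ->; exists x, y.
by exists x y => //; rewrite inE yS.
Qed.

Lemma perfect_matchingP S M :
  reflect [/\ {in M, forall E, exists x y, e x y /\ E = [set x; y]},
              trivIset M & cover M = S] (is_pm S M).
Proof.
rewrite /is_perfect_matching /is_matching.
apply: (iffP andP) => [[/andP[/subsetP sM tM] /eqP cM]|[sM tM cM]]; split=> //.
- by move=> E /sM /edgesP[x [y [_ _ exy ->]]]; exists x, y.
- apply/andP; split=> //; apply/subsetP => E EM.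
  have [x [y [exy EE]]] := sM E EM.
  have sES : E \subset S by rewrite -cM; apply: bigcup_sup EM.
  by apply/edgesP; exists x, y; rewrite exy EE; split=> //;
    apply: (subsetP sES); rewrite EE !inE eqxx ?orbT.
- exact/eqP.
Qed.

Lemma perfect_matching_add S M x v : is_pm S M -> x \notin S -> v \notin S ->
  e x v -> [set x; v] \notin M /\ is_pm (x |: (v |: S)) ([set x; v] |: M).
Proof.
move=> /perfect_matchingP[sM tM cM] xS vS exv.
have dM : {in M, forall E : {set T}, [disjoint [set x; v] & E]}.
  move=> E EM; rewrite disjoint_subset; apply/subsetP => z zxv; rewrite inE.
  apply/negP => zE; have: z \in S by rewrite -cM; apply/bigcupP; exists E.
  by case/set2P: zxv => ->; apply/negP.
have n0 : set0 \notin M.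
  apply/negP => /sM[y [z [_ /setP/(_ y)]]]; by rewrite !inE eqxx.
have [tM' nM] := trivIsetU1 dM tM n0.
split=> //; apply/perfect_matchingP; split=> //.
- by move=> E /setU1P[->|/sM//]; exists x, v.
- by rewrite /cover big_setU1 //= -/(cover M) cM setUA.
Qed.

Lemma perfect_matching_rem S M x v : is_pm S M -> [set x; v] \in M ->
  is_pm (S :\ x :\ v) (M :\ [set x; v]).
Proof.
move=> /perfect_matchingP[sM tM cM] EM.
apply/perfect_matchingP; split.
- by move=> E /setD1P[_ /sM].
- by apply: trivIsetS tM; apply: subD1set.
- apply/setP => z; rewrite !inE -cM; apply/bigcupP/and3P.
  + move=> [E /setD1P[EN EM'] zE].
    have /trivIsetP/(_ E _ EM' EM EN) dE := tM.
    have : z \notin [set x; v] by rewrite (disjointFr dE).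
    rewrite !inE negb_or => /andP[-> ->]; split=> //.
    by apply/bigcupP; exists E.
  + move=> [zv zx /bigcupP[E EM' zE]]; exists E => //; rewrite !inE EM' andbT.
    by apply: contraTneq zE => ->; rewrite !inE negb_or zx.
Qed.

Lemma num_pm_mem S x v : x \in S -> v \in S -> e x v ->
  #|[set M | is_pm S M & [set x; v] \in M]| = N (S :\ x :\ v).
Proof.
move=> xS vS exv; rewrite /num_perfect_matchings.
have xv : v != x by apply: contraTneq exv => ->; rewrite e_irrefl.
have SE : S = x |: (v |: (S :\ x :\ v)) by rewrite !setD1K // !inE xv.
have h M : M \in [set M | is_pm (S :\ x :\ v) M] ->
    [set x; v] \notin M /\ is_pm S ([set x; v] |: M).
  rewrite inE => /perfect_matching_add/(_ _ _ exv); rewrite -SE; apply;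
    by rewrite !inE eqxx ?andbF.
rewrite -(@card_in_imset _ _ (fun M => [set x; v] |: M)
   [set M | is_pm (S :\ x :\ v) M]).
  apply: eq_card => M; rewrite inE; apply/andP/imsetP => [[pM EM]|[M' pM' ->]].
    exists (M :\ [set x; v]); last by rewrite setD1K.
    by rewrite inE; apply: perfect_matching_rem.
  by rewrite (h _ pM').2 !inE eqxx.
move=> M M' /h[nM _] /h[nM' _] /(congr1 (fun A => A :\ [set x; v])).
by rewrite !setU1K.
Qed.

(** The counterpart for general graphs of the row expansion: each perfect matching is counted once,
    at the partner of [x]. *)
Lemma num_pm_expand S x : x \in S ->
  N S = (\sum_(v in S | e x v) N (S :\ x :\ v))%N.
Proof.
move=> xS.
rewrite /num_perfect_matchings -sum1_card.
transitivity (\sum_(M in [set M | is_pm S M])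
   \sum_(v in S | e x v) ([set x; v] \in M))%N.
  apply: eq_bigr => M; rewrite inE => /perfect_matchingP[sM tM cM].
  have [E EM xE] : exists2 E, E \in M & x \in E by apply/bigcupP; rewrite -/(cover M) cM.
  have [v [exv EE]] : exists v, e x v /\ E = [set x; v].
    have [y [z [eyz EE]]] := sM E EM.
    move: xE; rewrite EE !inE => /orP[]/eqP->; first by exists z.
    by exists y; rewrite e_sym setUC.
  have vS : v \in S by rewrite -cM; apply/bigcupP; exists E; rewrite // EE !inE eqxx orbT.
  rewrite (bigD1 v) ?vS //= -EE EM big1 // => w /andP[/andP[wS exw] wv].
  apply/eqP; rewrite eqb0; apply/negP => wM.
  have xw : w != x by apply: contraTneq exw => ->; rewrite e_irrefl.
  have /trivIsetP/(_ E _ EM wM) := tM.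
  have -> : E != [set x; w].
    apply/eqP => /setP/(_ w); rewrite EE !inE eqxx orbT => /orP[]/eqP E'.
      by rewrite E' eqxx in xw.
    by rewrite E' eqxx in wv.
  by move=> /(_ isT)/disjointFr/(_ xE); rewrite !inE eqxx.
rewrite exchange_big /=; apply: eq_bigr => v /andP[vS exv].
rewrite -[RHS]num_pm_mem // -sum1_card big_mkcond [RHS]big_mkcond /=.
by apply: eq_bigr => M _; rewrite !inE; case: is_pm; case: (_ \in M).
Qed.

Lemma num_pm0 : N set0 = 1%N.
Proof.
rewrite /num_perfect_matchings -(cards1 (set0 : {set {set T}})).
apply: eq_card => M; rewrite !inE; apply/perfect_matchingP/eqP => [[sM tM cM]|->].
  apply/eqP; apply: contraT => /set0Pn[E EM].
  have [x [y [_ EE]]] := sM E EM.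
  have : x \in set0 by rewrite -cM; apply/bigcupP; exists E; rewrite // EE !inE eqxx.
  by rewrite inE.
split=> [E||]; rewrite ?inE //; last by rewrite /cover big_set0.
by apply/trivIsetP => E E'; rewrite inE.
Qed.

(** With [feasible_edge], this turns the expansion into two moves on feasible sets, removing and
    adding a matched pair; the exchange property rests on these moves alone. *)
Lemma feasible_partner S x : x \in S -> feasible S ->
  exists v, [/\ v \in S, e x v & feasible (S :\ x :\ v)].
Proof.
move=> xS; rewrite (num_pm_expand xS) lt0n sum_nat_eq0 negb_forall.
by case/existsP => v; rewrite negb_imply -lt0n => /andP[/andP[vS exv] fv]; exists v.
Qed.

Lemma feasible_edge S x v : x \in S -> v \in S -> e x v ->
  feasible (S :\ x :\ v) -> feasible S.
Proof.
move=> xS vS exv fv; rewrite (num_pm_expand xS).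
by rewrite (bigD1 v) ?vS //= addn_gt0 fv.
Qed.

Lemma edge_neq x y : e x y -> y != x.
Proof. by apply: contraTneq => ->; rewrite e_irrefl. Qed.

Lemma feasible_even S : feasible S -> ~~ odd #|S|.
Proof.
have [n le_n] := ubnP #|S|; elim: n => // n IHn in S le_n *.
have [->|[x xS]] := set_0Vmem S; first by rewrite cards0.
case/(feasible_partner xS) => v [vS exv fv].
have vSx : v \in S :\ x by rewrite !inE edge_neq.
have cS : #|S| = #|S :\ x :\ v|.+2.
  by rewrite (cardsD1 x S) xS (cardsD1 v (S :\ x)) vSx.
have := IHn _ _ fv; rewrite cS /= negbK; apply.
by move: le_n; rewrite cS => /ltnW.
Qed.

(** The symmetric difference of [X] and [[set x; y]]. *)
Definition flip2 X x y : {set T} := [set z | (z \in X) (+) (z \in [set x; y])].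

(* The strong exchange property of the feasible sets: [y] is the other end of the
   component of [x] in the symmetric difference of a matching of [X] and one of
   [Y].  The induction walks along that alternating path one edge at a time. *)
Lemma exchange X Y x : feasible X -> feasible Y -> (x \in X) != (x \in Y) ->
  exists y, [/\ y != x, (y \in X) != (y \in Y),
                feasible (flip2 X x y) & feasible (flip2 Y x y)].
Proof.
have [n] := ubnP (#|X| + #|Y|); elim: n => // n IHn in X Y x *.
wlog xX : X Y / x \in X => [wl|].
  have [xX|xX] := boolP (x \in X); first by have := wl X Y xX; rewrite xX.
  move=> le_n fX fY; have [xY _|//] := boolP (x \in Y).
  have [] := wl Y X xY _ fY fX; rewrite 1?addnC ?(negbTE xX) ?xY //.
  by move=> y [yx yXY fYy fXy]; exists y; split; rewrite // eq_sym.
rewrite xX => le_n fX fY; case: (boolP (x \in Y)) => // xY _.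
have [x1 [x1X exx1 fX1]] := feasible_partner xX fX.
have x1x := edge_neq exx1.
(* If [x1] is outside [Y], the path stops after one edge, which [X] loses and [Y] gains. Otherwise
   it continues from [x1], which is in [Y] but no longer in [X :\ x :\ x1]. *)
have [x1Y|x1Y] := boolP (x1 \in Y); last first.
  exists x1; rewrite x1X (negbTE x1Y); split=> //.
    by rewrite (_ : flip2 X x x1 = X :\ x :\ x1) //; set_cases.
  apply: (@feasible_edge _ x x1) => //.
  + by rewrite !inE eqxx (negbTE xY).
  + by rewrite !inE eqxx orbT (negbTE x1Y).
  + by rewrite (_ : _ :\ x1 = Y) //; set_cases.
have [||||y [yx1 yXY fXy fYy]] := IHn (X :\ x :\ x1) Y x1.
- move: le_n; rewrite (cardsD1 x X) xX (cardsD1 x1 (X :\ x)) !inE x1X x1x.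
  by rewrite !addSn ltnS; apply: leq_trans; rewrite ltnS leqW.
- done.
- done.
- by rewrite !inE eqxx x1Y.
have yx : y != x.
  by apply: contraNneq yXY => ->; rewrite !inE eqxx andbF (negbTE xY).
exists y; split=> //.
- by move: yXY; rewrite !inE yx yx1.
- by rewrite (_ : flip2 X x y = flip2 (X :\ x :\ x1) x1 y) //; set_cases.
(* [flip2 Y x y] is [flip2 Y x1 y] with the matched pair [x], [x1] added. *)
- apply: (@feasible_edge _ x x1) => //.
  + by rewrite !inE eqxx (negbTE xY).
  + by rewrite !inE (negbTE x1x) x1Y eq_sym (negbTE yx1).
  + by rewrite (_ : _ :\ x1 = flip2 Y x1 y) //; set_cases.
Qed.

(** * The Gallai-Edmonds decomposition *)

Lemma matching_perfect S M :
  is_matching e S M -> is_pm (cover M) M /\ cover M \subset S.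
Proof.
move=> /andP[/subsetP sM tM]; split.
  apply/perfect_matchingP; split=> // E /sM /edgesP[x [y [_ _ exy ->]]].
  by exists x, y.
apply/bigcupsP => E /sM /edgesP[x [y [xS yS _ ->]]].
by apply/subsetP => z; rewrite !inE => /orP[]/eqP->.
Qed.

Lemma card_perfect_matching S M : is_pm S M -> #|S| = #|M|.*2.
Proof.
move=> /perfect_matchingP[sM tM <-]; rewrite -(eqP tM) -muln2 -sum_nat_const.
apply: eq_bigr => E /sM[x [y [exy ->]]].
by rewrite cards2 eq_sym edge_neq.
Qed.

(** A perfect matching of [S] leaves a matching of [S :\ u] missing only the partner of [u]; hence
    every maximum matching of [S :\ u] misses a single vertex. *)
Lemma mem_GE_D S u v : u \in S -> feasible S ->
  (v \in GE_D e (S :\ u)) = (v \in S :\ u) && feasible (S :\ u :\ v).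
Proof.
move=> uS fS; rewrite [LHS]inE; case: (boolP (v \in _)) => //= vS.
have le_pm S0 M : is_matching e S0 M -> (#|M|.*2 <= #|S0|)%N.
  move=> /matching_perfect[/card_perfect_matching <-]; exact: subset_leq_card.
have cS : #|S :\ u| = #|S :\ u :\ v|.+1 by rewrite (cardsD1 v (S :\ u)) vS.
apply/existsP/idP => [[M /andP[/andP[mM /forallP maxM] vM]]|].
  have [pM sM] := matching_perfect mM.
  have [w [wS euw]] := feasible_partner uS fS.
  rewrite card_gt0 => /set0Pn[M']; rewrite inE => pM'.
  have := maxM M'; have -> /= : is_matching e (S :\ u) M'.
    case/andP: (pM') => /andP[sM' tM'] _; rewrite /is_matching tM' andbT.
    apply: subset_trans sM' _; apply/subsetP => E /edgesP[x [y [xS yS exy ->]]].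
    apply/edgesP; exists x, y; split=> //.
      by move: xS; rewrite !inE => /and3P[_ -> ->].
    by move: yS; rewrite !inE => /and3P[_ -> ->].
  rewrite -leq_double -(card_perfect_matching pM) -(card_perfect_matching pM').
  rewrite card_gt0 => leM; apply/set0Pn; exists M; rewrite inE.
  suff <- : cover M = S :\ u :\ v by [].
  (* [cover M] lies in [S :\ u :\ v] and, [M] being maximum, has at least as many vertices as
     [S :\ u :\ w], a set of the same size. *)
  apply/eqP; rewrite eqEcard subsetD1 sM vM /=.
  apply: leq_trans leM; rewrite -ltnS -cS (cardsD1 w) !inE wS edge_neq //.
rewrite card_gt0 => /set0Pn[M]; rewrite inE => pM; exists M.
case/andP: (pM) => /andP[sM tM] /eqP cM.
rewrite cM !inE eqxx andbT; apply/andP; split.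
  rewrite /is_matching tM andbT; apply: subset_trans sM _.
  apply/subsetP => E /edgesP[x [y [xS yS exy ->]]]; apply/edgesP.
  by exists x, y; split=> //; [case/setD1P: xS|case/setD1P: yS].
(* Twice the size of [M'] is at most twice the size of [M] plus one, so parity gives the bound. *)
apply/forallP => M'; apply/implyP => /le_pm; rewrite cS (card_perfect_matching pM).
by move=> /leq_ltn_trans/(_ (ltnSn _)); rewrite -doubleS ltn_double ltnS.
Qed.

(** No perfect matching of [Z] has an edge leaving [K], so [K] is matched within itself; the
    induction removes its pairs one by one. *)
Lemma even_feasible_restrict (Z K : {set T}) : feasible Z -> K \subset Z ->
  (forall k a, k \in K -> a \in Z :\: K -> e k a -> ~ feasible (Z :\ k :\ a)) ->
  ~~ odd #|K|.
Proof.
have [n] := ubnP #|K|; elim: n => // n IHn in Z K *.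
have [->|[k kK]] := set_0Vmem K; first by rewrite cards0.
move=> le_n fZ sKZ hK; have kZ := subsetP sKZ _ kK.
have [x [xZ ekx fx]] := feasible_partner kZ fZ.
have xK : x \in K.
  by apply/negPn/negP => xK; apply: (hK k x) => //; rewrite inE xK.
have xk := edge_neq ekx.
have cK : #|K| = #|K :\ k :\ x|.+2.
  by rewrite (cardsD1 k K) kK (cardsD1 x (K :\ k)) !inE xk xK.
rewrite cK /= negbK; apply: (IHn (Z :\ k :\ x)) => //.
- by move: le_n; rewrite cK => /ltnW.
- by rewrite !setSD.
(* The condition passes to the smaller sets: putting the pair [k], [x] back turns a violation there
   into one in [Z]. *)
- move=> k' a; rewrite !inE => /and3P[k'x k'k k'K] /andP[aK /and3P[ax ak aZ]] ek'a f'.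
  apply: (hK k' a) => //; first by move: aK; rewrite inE ax ak aZ /= => ->.
  apply: (@feasible_edge _ k x) => //.
  + by rewrite !inE kZ andbT ![k == _]eq_sym ak k'k.
  + by rewrite !inE xZ andbT ![x == _]eq_sym ax k'x.
  + by rewrite (_ : _ :\ x = Z :\ k :\ x :\ k' :\ a) //; set_cases.
Qed.

(* [D] stands for [GE_D e (S :\ u)], known only through [mem_GE_D] so that
   [inE] does not unfold it. *)
Section GallaiEdmonds.
Variables (S : {set T}) (u : T) (D : {set T}).
Hypotheses (uS : u \in S) (fS : feasible S).
Local Notation S' := (S :\ u).
Hypothesis mem_D : forall v, (v \in D) = (v \in S') && feasible (S' :\ v).
Local Notation r := [rel x y | [&& x \in D, y \in D & e x y]].

(** Let [v] be the partner of [u] in [S :\ a :\ b]. In the main case, the feasible sets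
    [S' :\ a :\ b :\ v] and [S' :\ d] differ exactly in [v], [a], [b], [d]. Exchange at [v] makes
    feasible [S' :\ b], or [S' :\ a], excluded by [a \notin D], or [S' :\ a :\ b :\ d], which the
    edge from [a] to [d] completes to [S' :\ b]. *)
Lemma GE_A_partner a d b : a \in S' -> a \notin D -> d \in D -> e a d ->
  b \in S -> e a b -> feasible (S :\ a :\ b) -> b \in D.
Proof.
rewrite !inE => /andP[au aS] aD dD ead bS eab fab.
have ba := edge_neq eab; have da := edge_neq ead.
have naD : ~ feasible (S' :\ a).
  by move=> fa; move: aD; rewrite mem_D fa !inE au aS.
have bu : b != u.
  apply/eqP => bu; apply: naD; move: fab; rewrite bu.
  by rewrite (_ : S :\ a :\ u = S' :\ a) //; set_cases.
have memD x : x != u -> x \in S -> feasible (S' :\ x) -> x \in D.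
  by move=> xu xS fx; rewrite mem_D fx !inE xu xS.
apply: memD => //.
have uab : u \in S :\ a :\ b by rewrite !inE eq_sym bu eq_sym au.
have [v [vS euv fX]] := feasible_partner uab fab.
move: vS; rewrite !inE => /and3P[vb va vS].
have vu := edge_neq euv.
move: dD; rewrite mem_D => /andP[]; rewrite !inE => /andP[du dS] fY.
have [db|db] := eqVneq d b; first by rewrite -db.
have fd : feasible (S' :\ a :\ b :\ d) -> feasible (S' :\ b).
  move=> f; apply: (@feasible_edge _ a d) => //.
  + by rewrite !inE au aS eq_sym ba.
  + by rewrite !inE db du dS.
  + by rewrite (_ : _ :\ d = S' :\ a :\ b :\ d) //; set_cases.
have [vd|vd] := eqVneq v d.
  apply: fd; move: fX; rewrite vd.
  by rewrite (_ : S :\ _ :\ _ :\ _ :\ _ = S' :\ a :\ b :\ d) //; set_cases.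
have [|y [yv yXY]] := @exchange _ _ v fX fY.
  by rewrite !inE eqxx vd vu vS.
have : [|| y == a, y == b | y == d].
  move: yXY; rewrite !inE yv; case: (y == a) => //; case: (y == b) => //.
  by case: (y == d) => //; rewrite /= eqxx.
case/or3P => /eqP{yXY yv}->.
- by rewrite (_ : flip2 _ v a = S' :\ b) //; set_cases.
- by rewrite (_ : flip2 _ v b = S' :\ a) //; set_cases.
- by rewrite (_ : flip2 _ v d = S' :\ a :\ b :\ d) => [/fd//|]; set_cases.
Qed.

(* Walking from [v] to [k] inside the component, each step [v -- d] trades the
   uncovered vertex [v] for [d] without losing the edge [k -- a]: otherwise
   [a] could be left uncovered, i.e. [a] would lie in [D]. *)
Lemma GE_D_component_edge v k a : a \in S' -> a \notin D -> k \in D -> v \in D ->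
  e k a -> connect r v k -> ~ feasible (S' :\ v :\ k :\ a).
Proof.
rewrite !inE => /andP[au aS] aD kD vD eka /connectP[p].
have naD : ~ feasible (S' :\ a).
  by move=> fa; move: aD; rewrite mem_D fa !inE au aS.
have ak := edge_neq eka.
have memD x : x \in D -> [/\ x != u, x \in S, x != a & feasible (S' :\ x)].
  move=> xD; have := xD; rewrite mem_D !inE => /andP[/andP[-> ->] ->].
  split=> //; apply: contraTneq xD => ->; exact: aD.
have [ku kS _ _] := memD k kD.
elim: p v vD => [|d p IHp] v vD /=.
  (* Here [v] is [k], and the edge from [k] to [a] would make [S'] feasible although its order is
     odd. *)
  move=> _ <- f.
  have /feasible_even : feasible S'.
    apply: (@feasible_edge _ k a) => //; rewrite ?inE ?ku ?kS ?au ?aS //.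
    by move: f; rewrite (_ : S' :\ k :\ k = S' :\ k) //; set_cases.
  by have := feasible_even fS; rewrite (cardsD1 u S) uS add1n /= negbK => ->.
move=> /andP[/and3P[_ dD evd] pth lst f].
have [vu vS va _] := memD v vD; have [du dS da fY] := memD d dD.
have dv := edge_neq evd.
have [dk|dk] := eqVneq d k.
  apply: naD; apply: (@feasible_edge _ v d) => //.
  + by rewrite !inE va vu.
  + by rewrite !inE da du.
  + by rewrite dk (_ : _ :\ k = S' :\ v :\ k :\ a) //; set_cases.
have [vk|vk] := eqVneq v k.
  have /feasible_even : feasible S'.
    apply: (@feasible_edge _ k a) => //; rewrite ?inE ?ku ?kS ?au ?aS //.
    by move: f; rewrite vk (_ : S' :\ k :\ k = S' :\ k) //; set_cases.
  by have := feasible_even fS; rewrite (cardsD1 u S) uS add1n /= negbK => ->.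
(* Besides [v], the two sets differ in [k], [a] and [d]. The outcomes [k] and [a] make [S' :\ a]
   feasible, the latter through the edge from [v] to [d]; the outcome [d] advances the walk. *)
have [|y [yv yXY fX' fY']] := @exchange _ _ v f fY.
  by rewrite !inE eqxx vu vS [v == d]eq_sym dv !andbF.
have : [|| y == k, y == a | y == d].
  move: yXY; rewrite !inE yv; case: (y == a) => //; case: (y == k) => //.
  by case: (y == d) => //; rewrite /= eqxx.
case/or3P => /eqP yE; move: fX' fY'; rewrite {}yE => {y yv yXY} fX' fY'.
- by apply: naD; rewrite (_ : S' :\ a = flip2 (S' :\ v :\ k :\ a) v k) //; set_cases.
- apply: naD; apply: (@feasible_edge _ v d) => //.
  + by rewrite !inE va vu.
  + by rewrite !inE da du.
  + by rewrite (_ : _ :\ d = flip2 (S' :\ d) v a) //; set_cases.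
- apply: (IHp d) => //.
  by rewrite (_ : _ :\ a = flip2 (S' :\ v :\ k :\ a) v d) //; set_cases.
Qed.

Lemma connect_induced_sym : connect_sym r.
Proof.
by apply: sym_connect_sym => x y /=; rewrite e_sym; case: (x \in D); case: (y \in D).
Qed.

(** If [a1] or [a2] is [u], [GE_D_component_edge] applies directly. Otherwise remove [u] and its
    partner [v] and exchange at [v] with [S' :\ k1]: getting back [a1] or [a2] leads to that lemma,
    and getting back [k2] makes [S' :\ a2] feasible, against [a2 \notin D]. *)
Lemma GE_D_component_two_edges a1 k1 a2 k2 :
  a1 \in S -> a1 \notin D -> a2 \in S -> a2 \notin D -> a1 != a2 ->
  k1 \in D -> k2 \in D -> k1 != k2 -> connect r k1 k2 -> e a1 k1 -> e a2 k2 ->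
  ~ feasible (S :\ a1 :\ k1 :\ a2 :\ k2).
Proof.
move=> a1S a1D a2S a2D a12 k1D k2D k12 c12 ek1 ek2 f.
have c21 : connect r k2 k1 by rewrite connect_induced_sym.
have memD x : x \in D -> [/\ x != u, x \in S & feasible (S' :\ x)].
  by move=> xD; have := xD; rewrite mem_D !inE => /andP[/andP[-> ->] ->].
have [k1u k1S f1] := memD _ k1D; have [k2u k2S f2] := memD _ k2D.
have neD a k : a \notin D -> k \in D -> a != k.
  by move=> aD kD; apply: contraNneq aD => ->.
have a1k1 := neD _ _ a1D k1D; have a1k2 := neD _ _ a1D k2D.
have a2k1 := neD _ _ a2D k1D; have a2k2 := neD _ _ a2D k2D.
have [a1u|a1u] := eqVneq a1 u.
  have a2u : a2 != u by rewrite -a1u eq_sym.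
  apply: (@GE_D_component_edge k1 k2 a2) => //; rewrite ?inE ?a2u 1?e_sym //.
  by move: f; rewrite a1u (_ : _ :\ k2 = S' :\ k1 :\ k2 :\ a2) //; set_cases.
have [a2u|a2u] := eqVneq a2 u.
  apply: (@GE_D_component_edge k2 k1 a1) => //; rewrite ?inE ?a1u 1?e_sym //.
  by move: f; rewrite a2u (_ : _ :\ k2 = S' :\ k2 :\ k1 :\ a1) //; set_cases.
have [|v [vS euv fX]] := @feasible_partner _ u _ f.
  by rewrite !inE ![u == _]eq_sym k1u k2u a1u a2u.
have vu := edge_neq euv.
move: vS; rewrite !inE => /and5P[vk2 va2 vk1 va1 vS].
have [|y [yv yXY fX' _]] := @exchange _ _ v fX f1.
  by rewrite !inE eqxx vu vk1 vS.
have : [|| y == a1, y == a2 | y == k2].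
  move: yXY; rewrite !inE yv; case: (y == a1); case: (y == a2); case: (y == k2) => //=.
  by case: (y == k1) => //=; rewrite ?andbF ?eqxx.
case/or3P => /eqP yE; move: fX'; rewrite {}yE => fX'.
- apply: (@GE_D_component_edge k1 k2 a2) => //; rewrite ?inE ?a2u 1?e_sym //.
  by move: fX'; rewrite (_ : flip2 _ _ _ = S' :\ k1 :\ k2 :\ a2) //; set_cases.
- apply: (@GE_D_component_edge k2 k1 a1) => //; rewrite ?inE ?a1u 1?e_sym //.
  by move: fX'; rewrite (_ : flip2 _ _ _ = S' :\ k2 :\ k1 :\ a1) //; set_cases.
- move: a2D; rewrite mem_D !inE a2u a2S /= => /negP; apply.
  apply: (@feasible_edge _ a1 k1) => //; rewrite ?inE ?a1u ?a12 ?k1u ?k1S ?a1S //.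
    by rewrite eq_sym a2k1.
  by move: fX'; rewrite (_ : flip2 _ _ _ = S' :\ a2 :\ a1 :\ k1) //; set_cases.
Qed.

(** A neighbour outside the component [K] is outside [D], so by [GE_D_component_edge] no perfect
    matching of [S' :\ v] has an edge leaving [K :\ v], whose order is therefore even. *)
Lemma odd_GE_D_component v : v \in D -> odd #|component e D v|.
Proof.
move=> vD; set K := component e D v.
have vK : v \in K by rewrite inE vD connect0.
rewrite (cardsD1 v K) vK add1n /=.
have := vD; rewrite mem_D => /andP[vS' fv].
have sDS : D \subset S' by apply/subsetP => x; rewrite mem_D => /andP[].
apply: (even_feasible_restrict fv).
  by apply: setSD; apply: subset_trans sDS; apply/subsetP => x; rewrite inE => /andP[].
move=> k a; rewrite in_setD1 in_setD !in_setD1 => /andP[kv kK].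
rewrite negb_and negbK => /and3P[aK av aS'] eka f.
move: aK; rewrite (negbTE av) /= => aK.
have [kD ck] : k \in D /\ connect r v k by move: kK; rewrite inE => /andP.
have aD : a \notin D.
  apply: contra aK => aD; rewrite inE aD /=.
  by apply: connect_trans ck _; apply: connect1; rewrite /= kD aD.
by apply: (@GE_D_component_edge v k a) => //; rewrite in_setD1.
Qed.

End GallaiEdmonds.

(** * Counting along the decomposition *)

(** A vertex of [A] has all its possible partners in [A], so both sides expand over the same
    vertices. *)
Lemma num_pm_disjointU (A B : {set T}) : [disjoint A & B] ->
  (forall a b, a \in A -> b \in B -> ~~ e a b) -> N (A :|: B) = (N A * N B)%N.
Proof.
have [n] := ubnP #|A|; elim: n => // n IHn in A *.
have [->|[x xA]] := set_0Vmem A; first by rewrite set0U num_pm0 mul1n.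
move=> le_n dAB hAB.
have nB a : a \in A -> a \notin B by move=> aA; rewrite (disjointFr dAB aA).
rewrite (@num_pm_expand (A :|: B) x) ?inE ?xA // (num_pm_expand xA) big_distrl /=.
apply: eq_big => [v|v /andP[vA exv]].
  by rewrite inE; case: (v \in A) => //=; apply/negbTE/negP => /andP[/(hAB _ _ xA)/negP].
have {}vA : v \in A.
  by move: vA; rewrite inE => /orP[//|/(hAB _ _ xA)]; rewrite exv.
rewrite -IHn.
- congr (N _); apply/setP => z; rewrite !inE.
  have := nB x xA; have := nB v vA.
  case: eqP => [->|_]; first by rewrite /= => /negbTE->.
  by case: eqP => [->|_]; first by rewrite /= => _ /negbTE->.
- move: le_n; rewrite (cardsD1 x A) xA (cardsD1 v (A :\ x)) !inE edge_neq // vA.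
  by move=> /ltnW.
- by apply: disjointWl dAB; rewrite setDDl; apply: subsetDl.
- by move=> a b; rewrite !inE => /and3P[_ _]; apply: hAB.
Qed.

(** The bipartite graph of the algorithm with exact counts as weights, for any family [P] of blocks,
    since the induction below discards blocks. *)
Definition count_bigraph (R : realType) X (P : {set {set T}}) : wbigraph R T {set T} :=
  WBigraph X P (fun x K => [exists v in K, e x v])
    (fun x K => \sum_(v in K | e x v) (N (K :\ v))%:R).

(** The general [P] and [Z] allow induction on [X]: matching [x] to [v] in a block [K] discards [x]
    and [K] from the bipartite graph and moves [K :\ v] into [Z]. The last three hypotheses speak of
    feasible sets and are inherited by putting the pair [x], [v] back. *)
Lemma num_pm_block_decomposition (R : realType) S X (P : {set {set T}}) Z :
  S = X :|: cover P :|: Z ->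
  [disjoint X & cover P] -> [disjoint X & Z] -> [disjoint cover P & Z] ->
  trivIset P ->
  {in P &, forall K L : {set T}, K != L ->
     forall k l, k \in K -> l \in L -> ~~ e k l} ->
  {in cover P & Z, forall k z, ~~ e k z} ->
  (feasible S -> {in P, forall K : {set T}, odd #|K|}) ->
  {in X & X :|: Z, forall x y, e x y -> ~ feasible (S :\ x :\ y)} ->
  {in P, forall K : {set T}, {in X &, forall x x', x != x' ->
     {in K &, forall v v', v != v' -> e x v -> e x' v' ->
        ~ feasible (S :\ x :\ v :\ x' :\ v')}}} ->
  (N S)%:R = (N Z)%:R * weighted_permanent (count_bigraph R X P).
Proof.
have [n] := ubnP #|X|; elim: n => // n IHn in S X P Z *.
have [->|[x xX]] := set_0Vmem X.
  rewrite set0U => _ -> _ _ dPZ tP hP hPZ hodd _ _.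
  rewrite weighted_permanent_set0.
  have [->|[K KP]] := set_0Vmem P.
    by rewrite eqxx mulr1 /cover big_set0 set0U.
  have -> : (P == set0) = false by apply/negbTE/set0Pn; exists K.
  (* With [X] empty, the block [K] has no edge to the rest of [S], so [K] would be feasible, yet its
     order is odd. *)
  rewrite mulr0; apply/eqP; rewrite pnatr_eq0 -leqn0 leqNgt; apply/negP => f.
  have := hodd f K KP; apply/negP; apply: (feasible_even).
  have sKP : K \subset cover P by apply: bigcup_sup KP.
  have dK : [disjoint K & (cover P :\: K) :|: Z].
    rewrite disjoints_subset; apply/subsetP => k kK; rewrite !inE kK /=.
    by rewrite (disjointFr dPZ) // (subsetP sKP).
  have: feasible (K :|: ((cover P :\: K) :|: Z)).
    by rewrite setUA -{1}(setIidPr sKP) setID.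
  rewrite num_pm_disjointU // ?muln_gt0 => [/andP[]//|k l kK].
  rewrite !inE => /orP[/andP[lK /bigcupP[L LP lL]]|lZ]; last first.
    by apply: hPZ => //; apply: (subsetP sKP).
  apply: (hP K L) => //; by apply: contraNneq lK => ->.
move=> le_n ES dXP dXZ dPZ tP hP hPZ hodd hX hPX.
have xS : x \in S by rewrite ES !inE xX.
have memS v : v \in S = [|| v \in X, v \in cover P | v \in Z].
  by rewrite ES !inE orbA.
rewrite (weighted_permanent_expand _ _ _ xX) big_distrr /=.
rewrite (num_pm_expand xS) natr_sum /=.
(* By [hX], partners of [x] in [X] or [Z] contribute zero. *)
transitivity (\sum_(v in cover P | e x v) (N (S :\ x :\ v))%:R : R).
  rewrite big_mkcond [RHS]big_mkcond; apply: eq_bigr => v _.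
  rewrite memS; case: (boolP (v \in cover P)) => vP; first by rewrite orbT.
  rewrite /=; case: ifP => // /andP[vXZ exv].
  apply/eqP; rewrite pnatr_eq0 -leqn0 leqNgt; apply/negP.
  by apply: hX => //; rewrite inE.
rewrite big_trivIset_cond //= [RHS]big_mkcondr /=.
apply: eq_bigr => K KP.
have sKP : K \subset cover P by apply: bigcup_sup KP.
transitivity (\sum_(v in K | e x v) (N Z)%:R * ((N (K :\ v))%:R *
    weighted_permanent (count_bigraph R (X :\ x) (P :\ K)))); last first.
  case: ifP => [_|nK]; first by rewrite -big_distrr /= -big_distrl.
  rewrite big_pred0 // => v; apply/negP => /andP[vK exv].
  by move/negbT/exists_inP: nK; case; exists v.
apply: eq_bigr => v /andP[vK exv].
have vP := subsetP sKP _ vK.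
have vX : v \notin X by rewrite (disjointFl dXP vP).
have vZ : v \notin Z by rewrite (disjointFr dPZ vP).
have xP : x \notin cover P by rewrite (disjointFr dXP xX).
have xZ : x \notin Z by rewrite (disjointFr dXZ xX).
have vS : v \in S by rewrite memS vP orbT.
have cPK : cover (P :\ K) = cover P :\: K by apply: coverD1.
have KZ k : k \in K -> k \notin Z.
  by move=> kK; rewrite (disjointFr dPZ (subsetP sKP _ kK)).
have KX k : k \in K -> k \notin X.
  by move=> kK; rewrite (disjointFl dXP (subsetP sKP _ kK)).
have fadd y y' : y \in S -> y' \in S -> y != x -> y != v -> y' != x -> y' != v ->
    feasible (S :\ x :\ v :\ y :\ y') -> feasible (S :\ y :\ y').
  move=> yS y'S yx yv y'x y'v f; apply: (@feasible_edge _ x v) => //.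
  + by rewrite !inE xS andbT ![x == _]eq_sym yx y'x.
  + by rewrite !inE vS andbT ![v == _]eq_sym yv y'v.
  + by rewrite (_ : _ :\ v = S :\ x :\ v :\ y :\ y') //; set_cases.
rewrite (IHn (S :\ x :\ v) (X :\ x) (P :\ K) (Z :|: (K :\ v))).
- rewrite num_pm_disjointU ?natrM ?mulrA //.
    rewrite disjoint_sym disjoints_subset; apply/subsetP => k.
    by rewrite !inE => /andP[_ /KZ].
  move=> z k zZ; rewrite !inE e_sym => /andP[_ kK]; apply: hPZ => //.
  exact: (subsetP sKP).
- by move: le_n; rewrite (cardsD1 x X) xX.
- apply/setP => z; rewrite cPK ES !inE.
  have [->|zv] := eqVneq z v.
    by rewrite (negbTE vX) vK (negbTE vZ) /= !andbF.
  have [->|zx] := eqVneq z x.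
    rewrite (negbTE xP) (negbTE xZ) !andbF /=.
    by apply/esym; apply: contraNF xP; exact: subsetP.
  rewrite /=; have := subsetP sKP z; case: (z \in K); case: (z \in cover P) => //=;
    rewrite ?orbT ?orbF //; by move=> /(_ isT).
- rewrite cPK; apply: disjointWl (subD1set _ _) _.
  by apply: disjointWr dXP; apply: subsetDl.
- rewrite disjoints_subset; apply/subsetP => y; rewrite !inE => /andP[_ yX].
  rewrite (disjointFr dXZ yX) /= negb_and; apply/orP; right.
  by apply: contraL yX => /KX.
- rewrite cPK disjoints_subset; apply/subsetP => y; rewrite !inE => /andP[yK yP].
  by rewrite (disjointFr dPZ yP) (negbTE yK) andbF.
- by apply: trivIsetS tP; apply: subD1set.
- by move=> L L' /setD1P[_ LP] /setD1P[_ L'P]; apply: hP.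
- move=> k z; rewrite cPK => /setDP[kP kK]; rewrite !inE => /orP[zZ|/andP[_ zK]].
    exact: hPZ.
  case/bigcupP: kP => L LP kL; apply: (hP L K) => //.
  by apply: contraNneq kK => <-.
- move=> f L /setD1P[_ LP]; apply: hodd => //.
  exact: (@feasible_edge _ x v).
- move=> x' y /setD1P[x'x x'X] yXZ ex'y f.
  have x'S : x' \in S by rewrite memS x'X.
  have x'v : x' != v by apply: contraNneq vX => <-.
  move: yXZ; rewrite in_setU !inE => /orP[/andP[yx yX]|/orP[yZ|/andP[yv yK]]].
  + apply: (hX x' y) => //; rewrite ?inE ?yX //; apply: fadd => //.
      by rewrite memS yX.
    by apply: contraNneq vX => <-.
  + apply: (hX x' y) => //; rewrite ?inE ?yZ ?orbT //; apply: fadd => //.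
    * by rewrite memS yZ !orbT.
    * by apply: contraNneq xZ => <-.
    * by apply: contraNneq vZ => <-.
  (* An edge from [x'] to the part of [Z] coming from [K] would be a second matching edge from [X]
     into [K]. *)
  + by apply: (hPX K KP x x') f; rewrite // eq_sym.
- move=> L /setD1P[LK LP] y y' /setD1P[yx yX] /setD1P[y'x y'X] yy'.
  move=> k k' kL k'L kk' eyk ey'k' f.
  apply: (hPX L LP y y' yX y'X yy' k k' kL k'L kk' eyk ey'k').
  have kP : k \in cover P by apply/bigcupP; exists L.
  have k'P : k' \in cover P by apply/bigcupP; exists L.
  have nLK l : l \in L -> l != v.
    move=> lL; apply: contraNneq LK => lv.
    by rewrite -(def_pblock tP LP lL) lv (def_pblock tP KP vK).
  have [kv k'v] := (nLK _ kL, nLK _ k'L).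
  have kx : k != x by apply: contraNneq xP => <-.
  have k'x : k' != x by apply: contraNneq xP => <-.
  have yv : y != v by apply: contraNneq vX => <-.
  have y'v : y' != v by apply: contraNneq vX => <-.
  apply: (@feasible_edge _ x v) => //.
  + by rewrite !inE xS andbT ![x == _]eq_sym k'x y'x kx yx.
  + by rewrite !inE vS andbT ![v == _]eq_sym k'v y'v kv yv.
  + by rewrite (_ : _ :\ v = S :\ x :\ v :\ y :\ k :\ y' :\ k') //; set_cases.
Qed.

End PerfectMatchings.

(** * Connected components of an induced subgraph *)

Section Components.
Variables (T : finType) (e : rel T).
Hypothesis e_sym : symmetric e.
Implicit Types D K L : {set T}.

Lemma mem_component D v : v \in D -> v \in component e D v.
Proof. by move=> vD; rewrite inE vD connect0. Qed.

Lemma component_sub D v : component e D v \subset D.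
Proof. by apply/subsetP => w; rewrite inE => /andP[]. Qed.

Lemma component_eq D v w : w \in component e D v -> component e D w = component e D v.
Proof.
rewrite inE => /andP[wD cvw]; apply/setP => z; rewrite !inE.
by rewrite (same_connect (connect_induced_sym e_sym D) cvw).
Qed.

Lemma components_eq D K v : K \in components e D -> v \in K -> component e D v = K.
Proof. by case/imsetP => w _ -> /component_eq. Qed.

Lemma components_sub D K : K \in components e D -> K \subset D.
Proof. by case/imsetP => v _ ->; apply: component_sub. Qed.

Lemma cover_components D : cover (components e D) = D.
Proof.
apply/setP => v; apply/bigcupP/idP => [[K KP vK]|vD].
  exact: (subsetP (components_sub KP)).
by exists (component e D v); [apply: imset_f | apply: mem_component].
Qed.

Lemma trivIset_components D : trivIset (components e D).
Proof.
apply/trivIsetP => K L KP LP; apply: contraR => /pred0Pn[z /andP[zK zL]].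
by rewrite -(components_eq KP zK) -(components_eq LP zL).
Qed.

Lemma components_no_edge D : {in components e D &, forall K L, K != L ->
  forall k l, k \in K -> l \in L -> ~~ e k l}.
Proof.
move=> K L KP LP KL k l kK lL; apply: contra KL => ekl.
rewrite -(components_eq KP kK) -(components_eq LP lL) eq_sym.
have kD := subsetP (components_sub KP) _ kK.
have lD := subsetP (components_sub LP) _ lL.
apply/eqP/component_eq; rewrite inE lD /=; apply: connect1.
by rewrite /= kD lD.
Qed.

End Components.

(** * The recursion formula for the number of perfect matchings *)

Section Decomposition.
Variables (T : finType) (e : rel T).
Hypotheses (e_sym : symmetric e) (e_irrefl : irreflexive e).
Local Notation N S := (num_perfect_matchings e S).
Local Notation feasible S := (0 < N S)%N.

Lemma GE_AP (S : {set T}) a : reflect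
  [/\ a \in S, a \notin GE_D e S & exists2 d, d \in GE_D e S & e a d]
  (a \in GE_A e S).
Proof.
rewrite [_ \in GE_A e S]inE in_setD.
apply: (iffP andP) => [[/andP[aD aS] /exists_inP h]|[aS aD h]]; split=> //.
  by rewrite aD.
exact/exists_inP.
Qed.

(** The block decomposition with the components of [D] as blocks and [C] as the rest. An infeasible
    [S] is covered too: [mem_GE_D] is called only under the last three conditions, each of which
    supplies the feasibility of [S], if need be after adding edges back. *)
Lemma num_pm_recursion (R : realType) (S : {set T}) u : u \in S ->
  (N S)%:R = (N (GE_C e (S :\ u)))%:R * weighted_permanent
    (count_bigraph e R (u |: GE_A e (S :\ u)) (components e (GE_D e (S :\ u)))).
Proof.
move=> uS; set D := GE_D e _; set A := GE_A e _; set C := GE_C e _.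
have sDS : D \subset S :\ u by apply/subsetP => v; rewrite inE => /andP[].
have CE c : (c \in C) = [&& c \in S :\ u, c \notin D & c \notin A].
  by rewrite /C /GE_C in_setD in_setU negb_or andbC.
have AP a : a \in A -> [/\ a \in S :\ u, a \notin D & exists2 d, d \in D & e a d].
  by move/GE_AP.
have uD : u \notin D by apply/negP => /(subsetP sDS); rewrite !inE eqxx.
have uC : u \notin C by rewrite CE !inE eqxx.
have XP x : x \in u |: A -> x \in S /\ x \notin D.
  by move=> /setU1P[->//|/AP[/setD1P[_ ->]]].
have XZP y : y \in u |: A :|: C -> y \in S /\ y \notin D.
  by move=> /setUP[/XP//|]; rewrite CE => /and3P[/setD1P[_ ->] ->].
have memD (fS : feasible S) v :
    (v \in D) = (v \in S :\ u) && feasible (S :\ u :\ v).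
  exact: mem_GE_D.
apply: num_pm_block_decomposition => //.
- rewrite cover_components //; apply/setP => x; rewrite !in_setU in_set1 CE.
  have [->|xu] := eqVneq x u; first by rewrite uS.
  rewrite /= in_setD1 xu /=.
  have [xA|xA] /= := boolP (x \in A); first by have [/setD1P[]] := AP _ xA.
  rewrite andbT; have [xD|xD] /= := boolP (x \in D).
    by have /setD1P[] := subsetP sDS _ xD.
  by rewrite andbT.
- rewrite cover_components // disjoints_subset; apply/subsetP => x /XP[_ ?].
  by rewrite in_setC.
- rewrite disjoints_subset; apply/subsetP => x /setU1P[->|xA].
    by rewrite in_setC.
  by rewrite in_setC CE xA !andbF.
- rewrite cover_components // disjoints_subset; apply/subsetP => x xD.
  by rewrite in_setC CE xD !andbF.
- exact: trivIset_components.
- exact: components_no_edge.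
- move=> d c; rewrite cover_components // CE => dD /and3P[cS cD].
  apply: contra => edc; apply/GE_AP; split=> //; exists d => //.
  by rewrite e_sym.
- move=> fS K /imsetP[v vD ->].
  by apply: (odd_GE_D_component e_sym e_irrefl uS fS (memD fS)).
- move=> x y xX /XZP[yS yD] exy f.
  have [xS xD] := XP _ xX.
  have fS := feasible_edge e_sym e_irrefl xS yS exy f.
  (* The partner [y] would lie in [D]: by [memD] if [x] is [u], by [GE_A_partner] if [x] is in
     [A]. *)
  apply/negP: yD; rewrite negbK; case/setU1P: xX => [xu|/AP[xS' _ [d dD exd]]].
    rewrite memD // -{2}xu f !inE yS -xu (edge_neq e_irrefl exy) //.
  exact: (GE_A_partner e_sym e_irrefl uS (memD fS) xS' xD dD exd yS exy f).
- move=> K KP x x' /XP[xS xD] /XP[x'S x'D] xx' v v' vK v'K vv' exv ex'v' f.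
  have vD := subsetP (components_sub KP) _ vK.
  have v'D := subsetP (components_sub KP) _ v'K.
  have [_ vS] := setD1P (subsetP sDS _ vD).
  have [_ v'S] := setD1P (subsetP sDS _ v'D).
  have neD a k : a \notin D -> k \in D -> a != k.
    by move=> aD kD; apply: contraNneq aD => ->.
  have f1 : feasible (S :\ x :\ v).
    apply: (@feasible_edge _ _ e_sym e_irrefl _ x' v') => //.
      by rewrite !inE x'S [x' == x]eq_sym xx' neD.
    by rewrite !inE v'S eq_sym vv' eq_sym neD.
  have fS := feasible_edge e_sym e_irrefl xS vS exv f1.
  apply: (GE_D_component_two_edges e_sym e_irrefl uS fS (memD fS)
    xS xD x'S x'D xx' vD v'D vv' _ exv ex'v' f).
  have : v' \in component e D v by rewrite (components_eq e_sym KP vK).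
  by rewrite inE => /andP[].
Qed.

Lemma weighted_permanent_reduced (R : realType) u A D :
  weighted_permanent (reduced_bigraph e u A D
    (fun v => (N (component e D v :\ v))%:R)) =
  weighted_permanent (count_bigraph e R (u |: A) (components e D)).
Proof.
apply: eq_bigr => M /and3P[/subsetP sM _ _]; apply: eq_bigr => p /sM.
rewrite !inE /= => /andP[/andP[_ KP] _]; apply: eq_bigr => v /andP[vK _].
by rewrite (components_eq e_sym KP vK).
Qed.

End Decomposition.

(** * Accuracies *)

Section Approximation.
Variable R : realType.
Implicit Types d z Z : R.

Lemma approximates_ge0 d z Z : 0 <= Z -> approximates d z Z -> 0 <= z.
Proof. by move=> Z0 /andP[+ _]; apply: le_trans; rewrite mulr_ge0 ?expR_ge0. Qed.

Lemma approximates_refl d Z : 0 <= d -> 0 <= Z -> approximates d Z Z.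
Proof.
move=> d0 Z0; apply/andP; split.
  by rewrite ler_piMl // -expR0 ler_expR oppr_le0.
by rewrite ler_peMl // -expR0 ler_expR.
Qed.

Lemma approximates_trans d1 d2 x y z :
  approximates d1 x y -> approximates d2 y z -> approximates (d1 + d2) x z.
Proof.
move=> /andP[xy1 xy2] /andP[yz1 yz2].
rewrite /approximates opprD !expRD -!mulrA; apply/andP; split.
  by apply: le_trans xy1; rewrite ler_wpM2l ?expR_ge0.
by apply: le_trans xy2 _; rewrite ler_wpM2l ?expR_ge0.
Qed.

Lemma approximates_le d d' z Z : 0 <= Z -> d <= d' ->
  approximates d z Z -> approximates d' z Z.
Proof.
move=> Z0 dd' zZ; rewrite -[d'](subrKC d).
apply: approximates_trans zZ (approximates_refl _ Z0).
by rewrite subr_ge0.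
Qed.

Lemma approximatesM d1 d2 z1 Z1 z2 Z2 : 0 <= Z1 -> 0 <= Z2 ->
  approximates d1 z1 Z1 -> approximates d2 z2 Z2 ->
  approximates (d1 + d2) (z1 * z2) (Z1 * Z2).
Proof.
move=> Z1_ge0 Z2_ge0 h1 h2.
have z2_ge0 := approximates_ge0 Z2_ge0 h2.
have z1_ge0 := approximates_ge0 Z1_ge0 h1.
case/andP: h1 => l1 r1; case/andP: h2 => l2 r2.
rewrite /approximates opprD !expRD; apply/andP; split.
  by rewrite mulrACA ler_pM ?mulr_ge0 ?expR_ge0.
by rewrite mulrACA ler_pM.
Qed.

Lemma approximates_prod (I : finType) (A : {set I}) (F G : I -> R) d :
  {in A, forall i, 0 <= G i} -> {in A, forall i, approximates d (F i) (G i)} ->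
  approximates (d *+ #|A|) (\prod_(i in A) F i) (\prod_(i in A) G i).
Proof.
move=> G0 FG; rewrite -sumr_const.
(* Nonnegativity of the product is carried along because [approximatesM] asks for it. *)
suff [] : approximates (\sum_(i in A) d) (\prod_(i in A) F i) (\prod_(i in A) G i)
  /\ 0 <= \prod_(i in A) G i by [].
elim/big_rec3 : _ => [|i x y z iA [h x0]].
  by split=> //; apply: approximates_refl.
by split; [apply: approximatesM; auto | apply: mulr_ge0; auto].
Qed.

Lemma approximates_sum (I : finType) (P : pred I) (F G : I -> R) d :
  (forall i, P i -> approximates d (F i) (G i)) ->
  approximates d (\sum_(i | P i) F i) (\sum_(i | P i) G i).
Proof.
move=> FG; apply/andP; split; rewrite mulr_sumr; apply: ler_sum => i /FG /andP[] //.
Qed.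

Lemma weighted_permanent_ge0 (U V : finType) (B : wbigraph R U V) :
  nonneg_weights B -> 0 <= weighted_permanent B.
Proof.
move=> B0; apply: sumr_ge0 => M /and3P[/subsetP sM _ _].
by apply: prodr_ge0 => p /sM /B0.
Qed.

(** Every perfect matching has [#|X|] edges, so all the products share one accuracy, which summation
    preserves. *)
Lemma approximates_weighted_permanent (U V : finType) X Y (b : U -> V -> bool)
    (w w' : U -> V -> R) d :
  0 <= d -> nonneg_weights (WBigraph X Y b w') ->
  (forall x y, x \in X -> y \in Y -> b x y -> approximates d (w x y) (w' x y)) ->
  approximates (d *+ #|X|) (weighted_permanent (WBigraph X Y b w))
    (weighted_permanent (WBigraph X Y b w')).
Proof.
move=> d0 w'0 ww'; apply: approximates_sum => M pM.
have [<- _] := card_bperfect_matching pM.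
case/and3P: pM => /subsetP sM _ _.
apply: approximates_prod => p /sM; first exact: w'0.
by rewrite !inE => /andP[/andP[pX pY] bp]; apply: ww'.
Qed.

End Approximation.

(** * Correctness of the algorithm *)

Section RecursiveCountApproximates.
Variables (R : realType) (PERMANENT : permanent_subroutine R).
Hypothesis hPERMANENT : forall (U V : finType) (B : wbigraph R U V) (delta : R),
  nonneg_weights B -> 0 < delta ->
  returns_approx (@PERMANENT U V B delta) delta (weighted_permanent B).
Variables (T : finType) (e : rel T).
Hypotheses (e_sym : symmetric e) (e_irrefl : irreflexive e).
Implicit Types (S D K : {set T}) (eps : R).
Local Notation N S := (num_perfect_matchings e S).

Lemma nonneg_count_bigraph X P : nonneg_weights (count_bigraph e R X P).
Proof. by move=> p _; apply: sumr_ge0 => v _; apply: ler0n. Qed.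

(* As [|A| + 1] is at most the number of components of [G[D]] whenever the
   bipartite graph has a perfect matching, [2 (|A| + 1) <= n]: the accumulated
   error of the [m v] is at most [n / 2 * (eps / (2 * n)) = eps / 4]. *)
Lemma approximates_reduced S u (m : T -> R) eps :
  u \in S -> 0 < eps ->
  let D := GE_D e (S :\ u) in
  let A := GE_A e (S :\ u) in
  {in D, forall v, approximates (eps / (2 * #|S|%:R)) (m v)
     (N (component e D v :\ v))%:R} ->
  approximates (eps / 3) (weighted_permanent (reduced_bigraph e u A D m))
    (weighted_permanent (count_bigraph e R (u |: A) (components e D))).
Proof.
move=> uS eps0 D A hm; set n : R := #|S|%:R.
have n0 : 0 < n by rewrite ltr0n; apply/card_gt0P; exists u.
set d : R := eps / (2 * n); have d0 : 0 < d by rewrite divr_gt0 ?mulr_gt0.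
have wP0 := @nonneg_count_bigraph (u |: A) (components e D).
(* Without a perfect matching both permanents are empty sums; with one, [#|u |: A|] is the number of
   components. *)
have [M pM|noM] := pickP (is_bperfect_matching
    (count_bigraph e R (u |: A) (components e D))); last first.
  rewrite /weighted_permanent !big_pred0 //.
  by apply: approximates_refl; rewrite // divr_ge0 ?ltW.
have [cX cP] := card_bperfect_matching pM.
have sDS : D \subset S :\ u by apply/subsetP => v; rewrite inE => /andP[].
(* There are at most [#|D|] components, and [u |: A] and [D] are disjoint subsets of [S]. *)
have le_n : (2 * #|u |: A| <= #|S|)%N.
  rewrite mul2n -addnn -{2}cX cP.
  apply: leq_trans (leq_add (leqnn _) (leq_imset_card _ _)) _.
  have dXD : [disjoint u |: A & D].
    rewrite disjoints_subset; apply/subsetP => x /setU1P[->|/GE_AP[_ xD _]].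
      by rewrite in_setC; apply/negP => /(subsetP sDS); rewrite !inE eqxx.
    by rewrite in_setC.
  have [_] := leq_card_setU (u |: A) D; rewrite dXD => /eqP <-.
  apply: subset_leq_card; apply/subsetP => x.
  by move=> /setUP[/setU1P[->//|/GE_AP[/setD1P[]]//]|/(subsetP sDS)/setD1P[]].
apply: (@approximates_le _ (d *+ #|u |: A|)).
- exact: weighted_permanent_ge0.
- have le2 : 2 * #|u |: A|%:R <= n by rewrite -natrM ler_nat.
  rewrite -[d *+ _]mulr_natr /d mulrAC ler_pdivrMr ?mulr_gt0 //.
  have := ler_wpM2l (ltW eps0) le2; have := mulr_gt0 eps0 n0; lra.
rewrite -weighted_permanent_reduced //.
apply: approximates_weighted_permanent; first exact: ltW.
  by move=> p _; apply: sumr_ge0 => v _; apply: ler0n.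
move=> x K _ KP _; apply: approximates_sum => v /andP[vK _].
by apply: hm; apply: (subsetP (components_sub KP)).
Qed.

(** Induction on the order of [S], for all accuracies at once. Existence and correctness go
    together: a run needs a value of [PERMANENT], hence nonnegative weights, which correctness of
    the recursive calls provides. *)
Lemma recursive_count_returns_approx S eps : 0 < eps ->
  returns_approx (recursive_count PERMANENT e S eps) eps (N S)%:R.
Proof.
have [n] := ubnP #|S|; elim: n => // n IHn in S eps *.
move=> le_n eps0.
have eps3 : 0 < eps / 3 by rewrite divr_gt0.
have cardD1 u K : u \in S -> K \subset S :\ u -> (#|K| < n)%N.
  move=> uS /subset_leq_card leK; move: le_n; rewrite (cardsD1 u S) uS.
  exact: leq_ltn_trans leK.
have sDS u : GE_D e (S :\ u) \subset S :\ u.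
  by apply/subsetP => v; rewrite inE => /andP[].
have sub_n u v : u \in S ->
    (#|component e (GE_D e (S :\ u)) v :\ v| < n)%N.
  move=> uS; apply: (cardD1 u) => //; apply: subset_trans (sDS u).
  by apply: subset_trans (component_sub e _ v); apply: subD1set.
have C_n u : u \in S -> (#|GE_C e (S :\ u)| < n)%N.
  by move=> uS; apply: (cardD1 u) => //; apply: subsetDl.
have epsn u : u \in S -> 0 < eps / (2 * #|S|%:R).
  move=> uS; rewrite divr_gt0 ?mulr_gt0 // ltr0n.
  by apply/card_gt0P; exists u.
have reduced_ge0 u A D (m : T -> R) :
    {in D, forall v, 0 <= m v} -> nonneg_weights (reduced_bigraph e u A D m).
  move=> m0 p; rewrite !inE => /andP[/andP[_ KP] _].
  apply: sumr_ge0 => v /andP[vK _].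
  by apply: m0; apply: (subsetP (components_sub KP)).
split.
  have [S0|[u uS]] := set_0Vmem S.
    by exists 1; rewrite S0; apply: RC_empty.
  (* As [m] is a total function, a returned value is chosen for every [v], inside [D] or not. *)
  have /boolp.choice[m hm] : forall v, exists z, recursive_count PERMANENT e
      (component e (GE_D e (S :\ u)) v :\ v) (eps / (2 * #|S|%:R)) z.
    by move=> v; have [] := IHn _ _ (sub_n u v uS) (epsn u uS).
  have [[mC hC] _] := IHn _ _ (C_n u uS) eps3.
  have m_ge0 : {in GE_D e (S :\ u), forall v, 0 <= m v}.
    move=> v _; have [_ h] := IHn _ _ (sub_n u v uS) (epsn u uS).
    exact: approximates_ge0 (h _ (hm v)).
  have [[p hp] _] := hPERMANENT (reduced_ge0 u (GE_A e (S :\ u)) _ m m_ge0) eps3.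
  by exists (mC * p); apply: (RC_step uS (m := m)).
move=> z hz.
case: hz IHn le_n eps0 eps3 cardD1 sDS sub_n C_n epsn => {S eps z} [eps|S eps u m mC p].
  by move=> _ _ eps0 *; rewrite num_pm0; apply: approximates_refl => //; exact: ltW.
move=> D A C uS hm hC hp IHn le_n eps0 eps3 _ sDS sub_n C_n epsn.
have m_approx : {in D, forall v, approximates (eps / (2 * #|S|%:R)) (m v)
    (N (component e D v :\ v))%:R}.
  by move=> v vD; apply: (IHn _ _ (sub_n u v uS) (epsn u uS)).2; apply: hm.
have C_approx := (IHn _ _ (C_n u uS) eps3).2 _ hC.
have p_approx : approximates (eps / 3) p
    (weighted_permanent (reduced_bigraph e u A D m)).
  apply: (hPERMANENT _ eps3).2 hp; apply: reduced_ge0 => v vD.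
  exact: approximates_ge0 (m_approx v vD).
rewrite (num_pm_recursion e_sym e_irrefl R uS).
(* One third each for the count on [C], for [PERMANENT], and for the errors of the weights [m]. *)
have -> : eps = eps / 3 + (eps / 3 + eps / 3) by field.
apply: approximatesM C_approx _ => //.
  exact/weighted_permanent_ge0/nonneg_count_bigraph.
exact: approximates_trans p_approx (approximates_reduced uS eps0 m_approx).
Qed.

End RecursiveCountApproximates.

Theorem theorem5 (R : realType) (PERMANENT : permanent_subroutine R)
  (hPERMANENT : forall (U V : finType) (B : wbigraph R U V) (delta : R),
     nonneg_weights B -> 0 < delta ->
     returns_approx (PERMANENT U V B delta) delta (weighted_permanent B))
  (T : finType) (e : rel T) (e_sym : symmetric e) (e_irrefl : irreflexive e)
  (eps : R) (eps_gt0 : 0 < eps) :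
  returns_approx (recursive_count PERMANENT e [set: T] eps) eps
    (num_perfect_matchings e [set: T])%:R.
Proof. exact: recursive_count_returns_approx. Qed.
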